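(* Let $\mathcal G_c=(\mathcal V,\mathcal E_c)$ be a strongly connected edge-capacitated connectivity digraph, with link delays $d_o(i,j)=s\,T_c(i)+l(i,j)+M/A(i',j')$ for $(i,j)\in\mathcal E_c$. Let $\mathcal G_c^{(u)}=(\mathcal V,\mathcal E_c^{(u)})$ be the undirected weighted graph in which $(i,j)\in\mathcal E_c^{(u)}$ if and only if $(i,j)\in\mathcal E_c$ and $(j,i)\in\mathcal E_c$, with edge weights $d_c^{(u)}(i,j)=\frac{d_o(i,j)+d_o(j,i)}{2}$. Then any minimum weight spanning tree of $\mathcal G_c^{(u)}$ (seen as a digraph containing both orientations of each of its edges, each arc $(i,j)$ having delay $d_o(i,j)$) is a solution of the Minimal Cycle Time problem on $\mathcal G_c$ when the overlay is required to be undirected; that is, its cycle time is minimal among all undirected strongly connected spanning subdigraphs of $\mathcal G_c$.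
   Context: Setting. $\mathcal V$ is a finite set of $N\ge 2$ nodes (silos). Digraphs have no self-loops. The data are an integer $s\ge 1$, a model size $M>0$, computation times $T_c(i)\ge 0$ ($i\in\mathcal V$), and for each $(i,j)\in\mathcal E_c$ an end-to-end latency $l(i,j)\ge 0$ and an available bandwidth $A(i',j')>0$ of the core path from $i$ to $j$ (simply a number attached to the ordered pair $(i,j)$). In an edge-capacitated network the delay of a link is $d_o(i,j)=s\,T_c(i)+l(i,j)+M/A(i',j')$, independent of which overlay is chosen. Overlay. An overlay is a strongly connected spanning subdigraph $\mathcal G_o=(\mathcal V,\mathcal E_o)$ of $\mathcal G_c$. It is undirected if $(i,j)\in\mathcal E_o\Rightarrow(j,i)\in\mathcal E_o$. Cycle time. A circuit is a closed path $\gamma=(i_1,\dots,i_p=i_1)$, $p>1$, along arcs of $\mathcal G_o$; its length $|\gamma|$ is its number of arcs and $d_o(\gamma)=\sum_{k=1}^{p-1}d_o(i_k,i_{k+1})$. The cycle time of $\mathcal G_o$ is $\tau(\mathcal G_o)=\max_\gamma d_o(\gamma)/|\gamma|$, the maximum being over all circuits of $\mathcal G_o$. Minimal Cycle Time problem (MCT): given $\mathcal G_c$ and the delay data, find an overlay with minimal cycle time (among undirected overlays, if the overlay is required to be undirected). *)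

(* Defs.v *)
From mathcomp Require Import all_boot all_order all_algebra.

Set Implicit Arguments.
Unset Strict Implicit.
Unset Printing Implicit Defensive.

Import Order.TTheory GRing.Theory Num.Theory.
Local Open Scope ring_scope.

(* A digraph on the node set V is its arc relation E : rel V.  Having V as node
   type makes every subrelation of E a spanning subdigraph.  An undirected
   graph is a symmetric relation: both orientations of each edge are arcs. *)

Definition strongly_connected (V : finType) (E : rel V) : Prop :=
  forall i j, connect E i j.

Definition overlay (V : finType) (Ec Eo : rel V) : Prop :=
  subrel Eo Ec /\ strongly_connected Eo.

Definition undirected_overlay (V : finType) (Ec Eo : rel V) : Prop :=
  overlay Ec Eo /\ symmetric Eo.

(* The circuit (i_1, i_2, ..., i_p = i_1), p > 1, is given by x = i_1 and
   c = [:: i_2; ...; i_p]: its number of arcs is size c.  Nodes may repeat. *)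
Definition circuit (V : finType) (E : rel V) (x : V) (c : seq V) : bool :=
  [&& c != [::], path E x c & last x c == x].

Definition mean_delay (R : realFieldType) (V : finType) (d : V -> V -> R)
    (x : V) (c : seq V) : R :=
  (\sum_(w <- pairmap d x c) w) / (size c)%:R.

(* tau is the maximum (attained) of the mean delays of the circuits of E; there
   are infinitely many circuits, whence a relation and not a \max. *)
Definition is_cycle_time (R : realFieldType) (V : finType) (d : V -> V -> R)
    (E : rel V) (tau : R) : Prop :=
  (exists x c, circuit E x c /\ mean_delay d x c = tau) /\
  (forall x c, circuit E x c -> mean_delay d x c <= tau).

(* Existence of the cycle times is asserted, so that minimality cannot hold
   vacuously; they are unique, being maxima. *)
Definition undirected_MCT_solution (R : realFieldType) (V : finType)
    (Ec : rel V) (d : V -> V -> R) (Eo : rel V) : Prop :=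
  undirected_overlay Ec Eo /\
  exists2 tau, is_cycle_time d Eo tau &
    forall Eo', undirected_overlay Ec Eo' ->
      exists2 tau', is_cycle_time d Eo' tau' & tau <= tau'.

Definition link_delay (R : realFieldType) (V : finType) (s : nat) (M : R)
    (Tc : V -> R) (l A : V -> V -> R) (i j : V) : R :=
  s%:R * Tc i + l i j + M / A i j.

Definition bidirectional (V : finType) (Ec : rel V) : rel V :=
  [rel i j | Ec i j && Ec j i].

Definition mean_weight (R : realFieldType) (V : finType) (d : V -> V -> R)
    (i j : V) : R :=
  (d i j + d j i) / 2.

(* A cycle of an undirected graph has at least three distinct nodes: going back
   and forth along an edge is not one. *)
Definition acyclic (V : finType) (T : rel V) : Prop :=
  forall c : seq V, uniq c -> (2 < size c)%N -> ~~ cycle T c.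

Definition spanning_tree (V : finType) (E T : rel V) : Prop :=
  [/\ symmetric T, subrel T E, (forall i j, connect T i j) & acyclic T].

(* Each edge {i, j} appears in the sum as (i, j) and as (j, i), hence the
   division by 2; w is meant to be symmetric. *)
Definition graph_weight (R : realFieldType) (V : finType) (w : V -> V -> R)
    (T : rel V) : R :=
  (\sum_i \sum_(j | T i j) w i j) / 2.

Definition min_spanning_tree (R : realFieldType) (V : finType) (E : rel V)
    (w : V -> V -> R) (T : rel V) : Prop :=
  spanning_tree E T /\
  forall T', spanning_tree E T' -> graph_weight w T <= graph_weight w T'.

(* Main.v *)
Require Import Defs.
From mathcomp Require Import all_boot all_order all_algebra.
From mathcomp Require Import zify.

(** Every circuit splits into simple ones, so its mean delay is a weighted
    average of mean delays of simple circuits.  Hence a cycle time exists, and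
    in a tree, whose simple circuits go back and forth along an edge, it is the
    largest mean weight of an edge.  In any undirected overlay each edge gives
    a circuit too, so the cycle time is at least the largest mean weight of an
    edge.  Finally, a minimum weight spanning tree minimizes the largest edge
    weight: removing an edge (a, b) from it leaves two components, and every
    connected graph has an edge (i, j) between them; exchanging the two edges
    gives a spanning tree, whence w a b <= w i j. *)

Set Implicit Arguments.
Unset Strict Implicit.
Unset Printing Implicit Defensive.

Import Order.TTheory GRing.Theory Num.Theory.
Local Open Scope ring_scope.

(** * Circuits, their decomposition and the existence of the cycle time *)

Lemma not_uniq_split (V : eqType) (c : seq V) :
  ~~ uniq c -> exists c1 y c2 c3, c = c1 ++ y :: c2 ++ y :: c3.
Proof.
elim: c => //= z c IHc; rewrite negb_and negbK => /orP[zc|/IHc].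
  by case/splitPr: zc => c2 c3; exists [::], z, c2, c3.
by case=> c1 [y [c2 [c3 ->]]]; exists (z :: c1), y, c2, c3.
Qed.

Section CycleTime.
Variables (R : realFieldType) (V : finType) (d : V -> V -> R).
Implicit Types (E : rel V) (x y : V) (c : seq V) (t : R).

Lemma mean_delay_le x c t : c != [::] ->
  (mean_delay d x c <= t) = (\sum_(u <- pairmap d x c) u <= t * (size c)%:R).
Proof.
by move=> c0; rewrite /mean_delay ler_pdivrMr // ltr0n lt0n size_eq0.
Qed.

Lemma circuit_neq0 E x c : circuit E x c -> c != [::].
Proof. by case/and3P. Qed.

(** Cutting a circuit at a repeated node gives two shorter circuits. Lengths and total delays add
    up, so bounds on the two means carry over to the whole. Uniqueness concerns [c] alone, since [x]
    is also its last node. *)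
Lemma simple_circuit_bound E t :
  (forall x c, circuit E x c -> uniq c -> mean_delay d x c <= t) ->
  forall x c, circuit E x c -> mean_delay d x c <= t.
Proof.
move=> simple_le x c; have [n] := ubnP (size c); elim: n x c => // n IHn x c.
rewrite ltnS => le_cn Exc; have [/simple_le->//|] := boolP (uniq c).
case/not_uniq_split=> c1 [y [c2 [c3 Dc]]].
(* The first circuit skips the loop between the two visits of [y]; the second is that loop. *)
have [Ex1 Ey2] : circuit E x (c1 ++ y :: c3) /\ circuit E y (rcons c2 y).
  move: Exc; rewrite Dc /circuit => /and3P[_].
  rewrite !cat_path /= !cat_path /= !last_cat /= !last_cat /=.
  move=> /andP[-> /and4P[-> p2 e2 ->]] ->.
  by rewrite rcons_path last_rcons p2 e2 eqxx -size_eq0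
    -[rcons _ _ == _]size_eq0 size_cat size_rcons /= addnS.
have := IHn _ _ _ Ex1; have := IHn _ _ _ Ey2.
rewrite (mean_delay_le _ _ (circuit_neq0 Exc)).
rewrite (mean_delay_le _ _ (circuit_neq0 Ex1)).
rewrite (mean_delay_le _ _ (circuit_neq0 Ey2)).
have Ds : size c = (size (c1 ++ y :: c3) + size (rcons c2 y))%N.
  by rewrite Dc !size_cat size_rcons /= size_cat /=; lia.
have Dd : \sum_(u <- pairmap d x c) u =
    \sum_(u <- pairmap d x (c1 ++ y :: c3)) u +
    \sum_(u <- pairmap d y (rcons c2 y)) u.
  rewrite Dc -cats1 !pairmap_cat /= !big_cat /= !big_cons pairmap_cat.
  rewrite big_cat /=.
  rewrite !big_cons big_nil addr0 -!addrA; congr (_ + (_ + _)).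
  by rewrite addrA addrC.
(* Both pieces are nonempty, so each is strictly shorter than [c] and the induction applies. *)
have s1 : (0 < size (c1 ++ y :: c3))%N by rewrite size_cat addnS.
have s2 : (0 < size (rcons c2 y))%N by rewrite size_rcons.
rewrite Dd {1}Ds natrD mulrDr => le2 le1.
apply: lerD; [apply: le1 | apply: le2]; apply: leq_trans le_cn; rewrite Ds.
  by rewrite -addn1 leq_add2l.
by rewrite -add1n leq_add2r.
Qed.

(** Simple circuits have at most [#|V|] arcs, so there are finitely many of them, and a best one
    among them bounds all circuits. The given circuit ensures that the maximum is over a nonempty
    set. *)
Lemma cycle_time_exists E x c :
  circuit E x c -> uniq c -> exists tau, is_cycle_time d E tau.
Proof.
move=> Exc Uc.
have sizeU (s : seq V) : uniq s -> (size s <= #|V|)%N.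
  by move=> Us; rewrite -(card_uniqP Us) max_card.
pose P (p : V * #|V|.-bseq V) := circuit E p.1 p.2 && uniq p.2.
pose p0 := (x, Bseq (sizeU _ Uc)).
have Pp0 : P p0 by rewrite /P Exc.
case: (@arg_maxP _ _ _ p0 P (fun p => mean_delay d p.1 p.2) Pp0).
move=> p /andP[Ep _] maxp.
exists (mean_delay d p.1 p.2); split; first by exists p.1, p.2.
apply: simple_circuit_bound => y s Es Us.
by apply: (maxp (y, Bseq (sizeU _ Us))); rewrite /P Es.
Qed.

Lemma back_forth_circuit E x y : E x y -> E y x -> circuit E x [:: y; x].
Proof. by rewrite /circuit /= => -> ->; rewrite eqxx. Qed.

Lemma mean_delay_back_forth x y : mean_delay d x [:: y; x] = mean_weight d x y.
Proof. by rewrite /mean_delay /= !big_cons big_nil addr0. Qed.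

Lemma acyclic_circuit_bound E t : irreflexive E -> acyclic E ->
  (forall x y, E x y -> mean_weight d x y <= t) ->
  forall x c, circuit E x c -> mean_delay d x c <= t.
Proof.
move=> irrE acE le_t; apply: simple_circuit_bound => x c Exc Uc.
(* A simple circuit with one arc is a loop, with two arcs it goes back and forth along an edge, and
   with more it is a cycle. *)
case/and3P: (Exc); case: c Exc Uc => // y [|z [|u c]] Exc Uc _.
- by rewrite /= andbT => Exy /eqP yx; rewrite yx irrE in Exy.
- by rewrite /= => /andP[Exy _] /eqP->; rewrite mean_delay_back_forth le_t.
- move=> pc /eqP lc; case/negP: (acE _ Uc isT).
  by rewrite (cycle_path x) /= -[last u c]/(last x [:: y, z, u & c]) lc.
Qed.

End CycleTime.

(** * Exchanging edges of spanning trees *)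

Section Exchange.
Variable V : finType.
Implicit Types (E T : rel V) (a b i j x y : V).

Definition edge i j : rel V :=
  [rel x y | ((x, y) == (i, j)) || ((x, y) == (j, i))].

Definition add_edge T i j : rel V := [rel x y | T x y || edge i j x y].

Definition del_edge T i j : rel V := [rel x y | T x y && ~~ edge i j x y].

Lemma edge_sym i j : symmetric (edge i j).
Proof.
move=> x y; rewrite /edge /= !xpair_eqE orbC.
by rewrite (andbC (x == j)) (andbC (x == i)).
Qed.

Lemma add_edge_sym T i j : symmetric T -> symmetric (add_edge T i j).
Proof. by move=> symT x y; rewrite /add_edge /= symT edge_sym. Qed.

Lemma del_edge_sym T i j : symmetric T -> symmetric (del_edge T i j).
Proof. by move=> symT x y; rewrite /del_edge /= symT edge_sym. Qed.

Lemma sub_acyclic E T : subrel E T -> acyclic T -> acyclic E.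
Proof.
move=> sET acT c Uc c_gt2; apply: contra (acT c Uc c_gt2).
by apply: sub_cycle.
Qed.

Lemma edge_add_del T i j :
  symmetric T -> T i j -> T =2 add_edge (del_edge T i j) i j.
Proof.
move=> symT Tij x y; rewrite /add_edge /del_edge /=.
have [|_] := boolP (edge i j x y); last by rewrite andbT orbF.
by rewrite orbT /edge /= => /orP[/eqP[-> ->]|/eqP[-> ->]]; rewrite // symT.
Qed.

(** A simple path from [a] to [b] avoiding the edge has at least two arcs, so the edge closes it
    into a cycle of [T]. *)
Lemma del_edge_disconnects T a b :
  symmetric T -> acyclic T -> T a b -> a != b ->
  ~~ connect (del_edge T a b) a b.
Proof.
move=> symT acT Tab neq_ab; apply/negP => /connectP[p pathp lastp].
case/shortenP: pathp lastp => {}p pathp Up _ lastp.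
case: p pathp Up lastp => [|x [|y p]] pathp Up lastp.
- by rewrite /= lastp eqxx in neq_ab.
- by move: lastp pathp => /= <-; rewrite /del_edge /edge /= eqxx andbF.
- case/negP: (acT _ Up isT); rewrite (cycle_path a) /=.
  rewrite -[last y p]/(last a [:: x, y & p]) -lastp symT Tab /=.
  by move: pathp; apply: sub_path => u v /andP[].
Qed.

(* A cycle through the new edge would leave, once this edge is removed, a path
   in T joining its ends. *)
Lemma add_edge_acyclic T i j :
  symmetric T -> acyclic T -> ~~ connect T i j -> acyclic (add_edge T i j).
Proof.
move=> symT acT nij c Uc c_gt2; apply/negP => cycT'.
have [/allP Tnext|/allPn[x xc nTx]] := boolP (all (fun x => T x (next c x)) c).
  by case/negP: (acT _ Uc c_gt2); apply: cycle_from_next.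
have symC := sym_connect_sym symT.
have T'x := next_cycle cycT' xc.
(* Rotate the cycle so that it starts with the arc from [x] to [y], which is not in [T]. *)
have [k [|y q] Dk] := rot_to xc.
  by move: c_gt2; rewrite -(size_rot k) Dk.
have Dy : next c x = y by rewrite -(next_rot k Uc) Dk /= eqxx.
move: cycT' Uc c_gt2; rewrite -(rot_cycle k) -(rot_uniq k) -(size_rot k) Dk.
rewrite Dy in T'x nTx.
have xy : edge i j x y by case/orP: T'x => // Txy; rewrite Txy in nTx.
have nxy : ~~ connect T y x.
  by move: xy => /orP[/eqP[-> ->]|/eqP[-> ->]]; rewrite // symC.
(* The new edge joins [x] and [y]. Every other arc of the cycle avoids [y] or leaves [y] for a node
   other than [x], hence lies in [T]. *)
have T'E u v : add_edge T i j u v -> u != y -> v != y -> T u v.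
  case/orP=> // uv uy vy; move: xy uv uy vy; rewrite /edge /=.
  by case/orP=> /eqP[_ ->] /orP[] /eqP[-> ->]; rewrite eqxx.
have T'Ey v : add_edge T i j y v -> v != x -> T y v.
  case/orP=> // yv /eqP[]; move: xy yv; rewrite /edge /=.
  by case/orP=> /eqP[e1 e2] /orP[] /eqP[e3 e4]; congruence.
case: q {Dk} => [|z q] //= /and3P[_ T'yz]; rewrite rcons_path => /andP[pq lq].
rewrite !inE !negb_or.
move=> /and4P[/and3P[neq_xy neq_xz xq] /andP[neq_yz yq] _ _] _.
case/negP: nxy; apply: (@connect_trans _ _ z).
  by apply: connect1; apply: T'Ey; rewrite // eq_sym.
apply/connectP; exists (rcons q x); last by rewrite last_rcons.
apply: (@sub_in_path _ (predC1 y) (add_edge T i j)).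
- by move=> u v uy vy T'uv; apply: T'E.
- rewrite /= eq_sym neq_yz all_rcons /= neq_xy /=.
  by apply/allP => u uq /=; apply: contraNneq yq => <-.
- by rewrite rcons_path pq.
Qed.

(** Without the edge between [a] and [b], every node is still on the side of [a] or of [b]; the new
    edge joins these two sides. *)
Lemma add_edge_connected T a b i j :
  symmetric T -> (forall x y, connect (add_edge T a b) x y) ->
  connect T a i -> ~~ connect T a j -> forall x y, connect (add_edge T i j) x y.
Proof.
move=> symT connT ai naj.
have ab_or v : connect T a v || connect T b v.
  (* [U] contains [a] and is closed under the arcs of the connected graph [add_edge T a b], so it
     contains all nodes. *)
  pose U := [pred v | connect T a v || connect T b v].
  have clU : closed (add_edge T a b) U.
    apply: intro_closed; first exact/sym_connect_sym/add_edge_sym.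
    move=> x y; rewrite !inE => /orP[Txy|/orP[]/eqP[_ ->] _].
    + by move=> /orP[] /connect_trans/(_ (connect1 Txy))->; rewrite ?orbT.
    + by rewrite connect0 orbT.
    + by rewrite connect0.
  by have := closed_connect clU (connT a v); rewrite !inE connect0 => <-.
have bj : connect T b j by have := ab_or j; rewrite (negbTE naj).
have subT : subrel (connect T) (connect (add_edge T i j)).
  by apply: connect_sub => x y Txy; apply: connect1; rewrite /add_edge /= Txy.
have symC' := sym_connect_sym (add_edge_sym i j symT).
have ab : connect (add_edge T i j) a b.
  apply: connect_trans (subT _ _ ai) _.
  apply: (@connect_trans _ _ j); last by rewrite symC'; exact: subT.
  by apply: connect1; rewrite /add_edge /edge /= eqxx orbT.
have av v : connect (add_edge T i j) a v.
  case/orP: (ab_or v) => /subT // bv; exact: connect_trans ab bv.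
by move=> x y; apply: connect_trans (av y); rewrite symC'.
Qed.

Variables (R : realFieldType) (w : V -> V -> R).
Hypothesis w_sym : forall x y, w x y = w y x.

Lemma eq_graph_weight E T : E =2 T -> graph_weight w E = graph_weight w T.
Proof.
by move=> ET; congr (_ / 2); apply: eq_bigr => x _; apply: eq_bigl => y.
Qed.

Lemma graph_weight_add_edge T i j : i != j -> ~~ T i j -> ~~ T j i ->
  graph_weight w (add_edge T i j) = graph_weight w T + w i j.
Proof.
move=> neq_ij nTij nTji; rewrite /graph_weight /add_edge /edge !pair_big_dep /=.
(* The new edge contributes two distinct ordered pairs of equal weight; halving their sum leaves
   [w i j]. *)
rewrite (bigD1 (i, j)) ?eqxx ?orbT //= (bigD1 (j, i)) /=; last first.
  by rewrite eqxx !orbT xpair_eqE negb_and eq_sym neq_ij.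
rewrite (w_sym j i) addrA mulrDl [X in X + _]mulrDl -splitr addrC.
congr (_ / 2 + _); apply: eq_bigl => -[x y] /=.
have [[-> ->]|] := eqVneq (x, y) (i, j); first by rewrite (negbTE nTij) andbF.
have [[-> ->]|] := eqVneq (x, y) (j, i); first by rewrite (negbTE nTji) !andbF.
by rewrite !orbF !andbT.
Qed.

Lemma min_spanning_tree_bottleneck E T E' a b :
  min_spanning_tree E w T -> T a b -> a != b ->
  symmetric E' -> subrel E' E -> (forall x y, connect E' x y) ->
  exists i j, E' i j /\ w a b <= w i j.
Proof.
move=> [[symT subT connT acT] minT] Tab neq_ab symE' subE' connE'.
pose T0 := del_edge T a b.
have symT0 : symmetric T0 by exact: del_edge_sym.
have TE : T =2 add_edge T0 a b by exact: edge_add_del.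
have nab : ~~ connect T0 a b by exact: del_edge_disconnects.
(* If no arc of [E'] left the component of [a] in [T0], that component would be closed under [E'],
   hence contain [b]. *)
have [i [j [E'ij ai naj]]] : exists i j,
    [/\ E' i j, connect T0 a i & ~~ connect T0 a j].
  have [/forallP cl|] :=
      boolP [forall i, forall j, E' i j ==> connect T0 a i ==> connect T0 a j].
    case/negP: nab.
    have clS : closed E' (connect T0 a).
      apply: intro_closed; first exact: sym_connect_sym.
      move=> x y xy xS; have /forallP/(_ y) := cl x.
      by rewrite xy (_ : connect T0 a x = true).
    by have := closed_connect clS (connE' a b); rewrite !inE connect0 => <-.
  rewrite negb_forall => /existsP[i]; rewrite negb_forall => /existsP[j].
  by rewrite !negb_imply => /and3P[]; exists i, j.
exists i, j; split=> //.
have nij : ~~ connect T0 i j by apply: contra naj; apply: connect_trans.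
have neq_ij : i != j by apply: contraNneq nij => ->.
have subT0 : subrel T0 T by move=> x y /andP[].
have acT0 : acyclic T0 by exact: sub_acyclic acT.
have T'tree : spanning_tree E (add_edge T0 i j).
  split; first exact: add_edge_sym.
  - move=> x y /orP[/subT0/subT //|/orP[]/eqP[-> ->]]; apply: subE' => //.
    by rewrite symE'.
  - apply: (@add_edge_connected T0 a b) ai naj => // x y.
    by rewrite -(eq_connect TE).
  - exact: add_edge_acyclic.
(* Both trees are [T0] plus one edge, so comparing their weights compares [w a b] with [w i j]. *)
have := minT _ T'tree; rewrite (eq_graph_weight TE) !graph_weight_add_edge //.
- by rewrite lerD2l.
- by apply: contra nij; apply: connect1.
- by rewrite symT0; apply: contra nij; apply: connect1.
- by apply: contra nab; apply: connect1.
- by rewrite symT0; apply: contra nab; apply: connect1.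
Qed.

End Exchange.

(** * Cycle times of undirected overlays and optimality of the tree *)

Lemma strongly_connected_arc (V : finType) (E : rel V) :
  (2 <= #|V|)%N -> strongly_connected E -> exists x y, E x y.
Proof.
move=> /card_gt1P[x [y [_ _ neq_xy]]] /(_ x y)/connectP[[|z p] /=].
  by move=> _ eq_yx; rewrite eq_yx eqxx in neq_xy.
by case/andP=> Exz _ _; exists x, z.
Qed.

(** An arc and its reverse form a simple circuit, from which a cycle time is obtained. *)
Lemma undirected_overlay_cycle_time (R : realFieldType) (V : finType)
    (d : V -> V -> R) (Ec E : rel V) :
  (2 <= #|V|)%N -> irreflexive Ec -> undirected_overlay Ec E ->
  exists tau, is_cycle_time d E tau.
Proof.
move=> hN irrEc [[subE connE] symE].
have [x [y Exy]] := strongly_connected_arc hN connE.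
have Eyx : E y x by rewrite symE.
apply: (cycle_time_exists d (back_forth_circuit Exy Eyx)).
rewrite /= inE andbT; apply/eqP => yx.
by have := subE _ _ Exy; rewrite yx irrEc.
Qed.

Theorem proposition3p1 (R : realFieldType) (V : finType) (Ec : rel V)
    (s : nat) (M : R) (Tc : V -> R) (l A : V -> V -> R)
    (hN : (2 <= #|V|)%N)
    (hs : (1 <= s)%N)
    (hM : 0 < M)
    (hTc : forall i, 0 <= Tc i)
    (hl : forall i j, Ec i j -> 0 <= l i j)
    (hA : forall i j, Ec i j -> 0 < A i j)
    (hirr : irreflexive Ec)
    (hconn : strongly_connected Ec)
    (T : rel V)
    (hT : min_spanning_tree (bidirectional Ec)
            (mean_weight (link_delay s M Tc l A)) T) :
  undirected_MCT_solution Ec (link_delay s M Tc l A) T.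
Proof.
set d := link_delay s M Tc l A in hT *.
have [[symT subT connT acT] _] := hT.
have subTc : subrel T Ec by move=> x y /subT/andP[].
have irrT : irreflexive T by move=> x; apply: contraFF (hirr x) => /subTc.
have ovT : undirected_overlay Ec T by [].
have [tau tauP] := undirected_overlay_cycle_time d hN hirr ovT.
split=> //; exists tau => // Eo' ovE'.
have [tau' tau'P] := undirected_overlay_cycle_time d hN hirr ovE'.
exists tau' => //; case: tauP => -[x [c [Txc <-]]] _.
have [[subE' connE'] symE'] := ovE'.
(* As [tau] is attained by a circuit of the tree, it suffices to bound the mean weight of each tree
   edge by [tau']. *)
apply: (acyclic_circuit_bound irrT acT) Txc => a b Tab.
have neq_ab : a != b by apply: contraTneq Tab => ->; rewrite irrT.
have w_sym u v : mean_weight d u v = mean_weight d v u.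
  by rewrite /mean_weight addrC.
have subE'b : subrel Eo' (bidirectional Ec).
  by move=> u v E'uv; rewrite /bidirectional /= !subE' // symE'.
have [i [j [E'ij le_w]]] :=
  min_spanning_tree_bottleneck w_sym hT Tab neq_ab symE' subE'b connE'.
(* The weight of the heavier edge found in [Eo'] is the mean delay of a circuit of [Eo'], hence at
   most [tau']. *)
apply: le_trans le_w _; rewrite -mean_delay_back_forth.
by apply: tau'P.2; apply: back_forth_circuit; rewrite // symE'.
Qed.
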